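(* Let the prior joint distribution of the losses $(X,Y)$ be bivariate normal with means $\mu_X,\mu_Y$, standard deviations $\sigma_X,\sigma_Y>0$ and correlation $\rho\in(-1,1)$, let $\alpha\in(0,1)$, let $\rho_1\in(-1,1)$, and let $\tilde\rho$ denote the posterior correlation coefficient of $X$ and $Y$ (under the entropy-pooling posterior described in the context). (i) Under the equality view $\tilde\rho=\rho_1$, $$\mathrm{CoVaR}_\alpha^{Y|\tilde\rho=\rho_1}=\mu_Y+\sigma_Y\left(\frac{1-\rho^2}{1-\rho\rho_1}\right)^{1/2}\Phi^{-1}(\alpha).$$ (ii) Under the inequality view $\tilde\rho\le\rho_1$: if $\rho\le\rho_1$, then $\mathrm{CoVaR}_\alpha^{Y|\tilde\rho\le\rho_1}=\mathrm{VaR}_\alpha^Y$; if $\rho>\rho_1$, then $\mathrm{CoVaR}_\alpha^{Y|\tilde\rho\le\rho_1}=\mathrm{CoVaR}_\alpha^{Y|\tilde\rho=\rho_1}$. (iii) Under the inequality view $\tilde\rho\ge\rho_1$: if $\rho\ge\rho_1$, then $\mathrm{CoVaR}_\alpha^{Y|\tilde\rho\ge\rho_1}=\mathrm{VaR}_\alpha^Y$; if $\rho<\rho_1$, then $\mathrm{CoVaR}_\alpha^{Y|\tilde\rho\ge\rho_1}=\mathrm{CoVaR}_\alpha^{Y|\tilde\rho=\rho_1}$.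
   Context: Entropy-pooling framework: given a ''view'' $V$ (a constraint on the posterior parameters), the posterior distribution of $(X,Y)$ is the bivariate normal distribution with means $\tilde\mu_X,\tilde\mu_Y$, standard deviations $\tilde\sigma_X,\tilde\sigma_Y>0$ and correlation $\tilde\rho\in(-1,1)$ that minimizes the relative entropy (Kullback–Leibler divergence) $\varepsilon(\tilde f,f)=\int \tilde f\,(\ln\tilde f-\ln f)$ of its density $\tilde f$ with respect to the prior density $f$, among all bivariate normal distributions satisfying $V$. The general CoVaR under view $V$ is $\mathrm{CoVaR}_\alpha^{Y|V}=\tilde\mu_Y+\tilde\sigma_Y\Phi^{-1}(\alpha)$, where $\Phi$ is the standard normal cdf. $\mathrm{VaR}_\alpha^Y=\mu_Y+\sigma_Y\Phi^{-1}(\alpha)$. *)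

(* Defs.v *)
From HB Require Import structures.
From mathcomp Require Import all_boot all_order all_algebra.
From mathcomp Require Import all_classical all_reals all_analysis.
Set Implicit Arguments. Unset Strict Implicit. Unset Printing Implicit Defensive.
Import Order.TTheory GRing.Theory Num.Theory.
Local Open Scope classical_set_scope.
Local Open Scope ring_scope.

Section EntropyPooling.
Variable R : realType.

Definition Phi (x : R) : R :=
  fine (\int[@lebesgue_measure R]_(t in `]-oo, x]) (normal_pdf 0 1 t)%:E)%E.

Definition Phi_inv (alpha : R) : R := inf [set x : R | alpha <= Phi x].

Definition bvn_pdf (mx my sx sy r : R) (z : R * R) : R :=
  let u := (z.1 - mx) / sx in
  let v := (z.2 - my) / sy in
  (2 * pi * sx * sy * Num.sqrt (1 - r ^+ 2))^-1 *
  expR (- (u ^+ 2 - 2 * r * u * v + v ^+ 2) / (2 * (1 - r ^+ 2))).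

Definition rel_entropy (ft f : R * R -> R) : \bar R :=
  (\int[(@lebesgue_measure R \x @lebesgue_measure R)%E]_z
     (ft z * (ln (ft z) - ln (f z)))%:E)%E.

Definition bvn_params (mx my sx sy r : R) : Prop :=
  0 < sx /\ 0 < sy /\ -1 < r /\ r < 1.

Definition EP_posterior (V : R -> Prop) (mx my sx sy r : R)
    (mx' my' sx' sy' r' : R) : Prop :=
  bvn_params mx' my' sx' sy' r' /\ V r' /\
  forall m1 m2 s1 s2 q, bvn_params m1 m2 s1 s2 q -> V q ->
    (rel_entropy (bvn_pdf mx' my' sx' sy' r') (bvn_pdf mx my sx sy r)
     <= rel_entropy (bvn_pdf m1 m2 s1 s2 q) (bvn_pdf mx my sx sy r))%E.

Definition CoVaR_post (alpha my' sy' : R) : R := my' + sy' * Phi_inv alpha.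

Definition VaR (alpha my sy : R) : R := my + sy * Phi_inv alpha.

Definition CoVaR_view_is (V : R -> Prop) (alpha mx my sx sy r c : R) : Prop :=
  (exists mx' my' sx' sy' r', EP_posterior V mx my sx sy r mx' my' sx' sy' r') /\
  forall mx' my' sx' sy' r', EP_posterior V mx my sx sy r mx' my' sx' sy' r' ->
    CoVaR_post alpha my' sy' = c.

End EntropyPooling.

(* Main.v *)
(** The relative entropy of two bivariate normal densities is computed from the
    second moments of the standard normal law. In the scaled standard
    deviations a, b and the scaled mean shifts it splits into a cost g(q)
    depending only on the posterior correlation q, a positive semidefinite form
    in a - b and the mean shifts, and a term t - 1 - ln t where t is
    ab(1 - rho q)/(1 - rho^2). Hence for fixed q the unique minimizer keeps the
    prior means and rescales both deviations by sqrt((1 - rho^2)/(1 - rho q)).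
    As g is strictly decreasing below rho and strictly increasing above it, an
    inequality view either leaves the prior unchanged or binds at rho1. *)
Require Import Defs.
From HB Require Import structures.
From mathcomp Require Import all_boot all_order all_algebra.
From mathcomp Require Import all_classical all_reals all_analysis.
From mathcomp Require Import measurable_realfun ring lra.
Import Order.TTheory GRing.Theory Num.Theory.
Import numFieldNormedType.Exports.
Local Open Scope classical_set_scope.
Local Open Scope ring_scope.

(** * Total mass and second moment of the Gaussian weight *)

Section gaussian_moments.
Context {R : realType}.
Notation mu := (@lebesgue_measure R).

Definition gaussian (x : R) : R := expR (- (x ^+ 2 / 2)).

Lemma gaussian_ge0 x : 0 <= gaussian x. Proof. exact: expR_ge0. Qed.

Lemma gaussianN x : gaussian (- x) = gaussian x.
Proof. by rewrite /gaussian sqrrN. Qed.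

Lemma is_derive_gaussian (x : R) : is_derive x 1 gaussian (- x * gaussian x).
Proof.
apply: is_derive_eq.
by rewrite /GRing.scale/= -/(gaussian x); field.
Qed.

Lemma continuous_gaussian : continuous gaussian.
Proof.
move=> x; apply/differentiable_continuous/derivable1_diffP.
by have [] := is_derive_gaussian x.
Qed.

Lemma measurable_gaussian : measurable_fun setT gaussian.
Proof. exact: continuous_measurable_fun continuous_gaussian. Qed.

Lemma integral_gaussian :
  (\int[mu]_x (gaussian x)%:E = (Num.sqrt (2 * pi))%:E)%E.
Proof.
have s0 : Num.sqrt (2 * pi : R) != 0.
  by rewrite gt_eqF// sqrtr_gt0 mulr_gt0// pi_gt0.
have -> : (fun x => (gaussian x)%:E) =
  (fun x => (Num.sqrt (2 * pi))%:E * (normal_pdf 0 1 x)%:E)%E.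
  apply/funext => x; rewrite normal_pdfE ?oner_neq0// -EFinM; congr EFin.
  rewrite /normal_peak /normal_fun expr1n mul1r -(mulr_natl pi) mulrA divff// mul1r.
  by rewrite /gaussian subr0 mulNr.
rewrite integralZl//; last exact: integrable_normal_pdf.
by rewrite integral_normal_pdf mule1.
Qed.


(* Adding [h] makes the derivative of [- x * gaussian x] nonnegative, as the
   improper fundamental theorem of calculus requires; [2] is large enough for
   [h] to dominate both [gaussian x] and [x * gaussian x]. *)
Let h (x : R) : R := expR (2 - x).

Let is_derive_h (x : R) : is_derive x 1 h (- h x).
Proof. by apply: is_derive_eq; rewrite /GRing.scale/= -/(h x); ring. Qed.

Let continuous_h : continuous h.
Proof.
move=> x; apply/differentiable_continuous/derivable1_diffP.
by have [] := is_derive_h x.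
Qed.

Let cvg_h : h x @[x --> +oo] --> 0.
Proof.
have -> : h = (fun x => expR 2 * expR (- x)).
  by apply/funext => x; rewrite /h expRD.
by rewrite -(mulr0 (expR 2)); apply: cvgM; [exact: cvg_cst|exact: cvgr_expR].
Qed.

Let gaussian_le_h x : gaussian x <= h x.
Proof. by rewrite ler_expR; have := sqr_ge0 (x - 1); nra. Qed.

Let cvg_x_gaussian : x * gaussian x @[x --> +oo] --> 0.
Proof.
apply: (@squeeze_cvgr _ _ _ _ (cst 0) h); [|exact: cvg_cst|exact: cvg_h].
near=> x; have x0 : 0 <= x by near: x; exact: nbhs_pinfty_ge.
rewrite /= mulr_ge0 ?gaussian_ge0//=.
(* Bounding [x] by [expR x] leaves a comparison of exponents, [x - x ^+ 2 / 2 <= 2 - x], which is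
   [0 <= (x - 2) ^+ 2]. *)
apply: (@le_trans _ _ (expR x * gaussian x)).
  by rewrite ler_wpM2r ?gaussian_ge0// (le_trans _ (expR_ge1Dx x))// lerDr.
by rewrite -expRD ler_expR; have := sqr_ge0 (x - 2); nra.
Unshelve. all: by end_near. Qed.

Let integral_h : (\int[mu]_(x in `[0%R, +oo[) (h x)%:E = (expR 2)%:E)%E.
Proof.
rewrite (@ge0_continuous_FTC2y _ _ (fun x => - h x) _ 0).
- by rewrite /h subr0 EFinN oppeK add0e.
- by move=> x _; exact: expR_ge0.
- exact/continuous_subspaceT/continuous_h.
- by rewrite -oppr0; apply: cvgN; exact: cvg_h.
- by move=> x _; apply: derivableN; have [] := is_derive_h x.
- by apply: cvgN; apply/cvg_at_right_filter; exact: continuous_h.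
- move=> x _; rewrite derive1E.
  by have [_ ->] := is_deriveN (is_derive_h x); rewrite opprK.
Qed.

Let F (x : R) : R := - (x * gaussian x) - h x.

Let f (x : R) : R := (x ^+ 2 - 1) * gaussian x + h x.

Let is_derive_F (x : R) : is_derive x 1 F (f x).
Proof.
rewrite /F /f; have := is_derive_gaussian x; have := is_derive_h x => Dh Dg.
apply: is_derive_eq; rewrite /GRing.scale/=; ring.
Qed.

Let continuous_f : continuous f.
Proof.
move=> x; apply: cvgD; last exact: continuous_h.
apply: cvgM; last exact: continuous_gaussian.
by apply: cvgB; [exact: exprn_continuous|exact: cvg_cst].
Qed.

Let f_ge0 x : 0 <= f x.
Proof.
by rewrite /f; have := gaussian_le_h x; have := gaussian_ge0 x;
  have := sqr_ge0 x; nra.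
Qed.

Let integral_f : (\int[mu]_(x in `[0%R, +oo[) (f x)%:E = (expR 2)%:E)%E.
Proof.
rewrite (@ge0_continuous_FTC2y _ _ F _ 0).
- by rewrite /F /h mul0r subr0 oppr0 add0r sub0r EFinN oppeK.
- by move=> x _; exact: f_ge0.
- exact/continuous_subspaceT/continuous_f.
- have -> : 0 = - 0 - 0 :> R by rewrite !oppr0 addr0.
  apply: cvgB; last exact: cvg_h.
  by apply: cvgN; exact: cvg_x_gaussian.
- by move=> x _; have [] := is_derive_F x.
- apply/cvg_at_right_filter/differentiable_continuous/derivable1_diffP.
  by have [] := is_derive_F 0.
- by move=> x _; rewrite derive1E; have [_ ->] := is_derive_F x.
Qed.

Lemma continuous_sqr_gaussian : continuous (fun x : R => x ^+ 2 * gaussian x).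
Proof.
by move=> x; apply: cvgM; [exact: exprn_continuous|exact: continuous_gaussian].
Qed.

(** Integration by parts: [(x ^+ 2 - 1) * gaussian x] is the derivative of [- (x * gaussian x)],
    which vanishes at 0 and at infinity. *)
Lemma integral0y_sqr_gaussian :
  (\int[mu]_(x in `[0%R, +oo[) (x ^+ 2 * gaussian x)%:E =
   \int[mu]_(x in `[0%R, +oo[) (gaussian x)%:E)%E.
Proof.
have mc (k : R -> R) : continuous k ->
    measurable_fun (`[0, +oo[ : set R) (fun x => (k x)%:E).
  move=> ck; apply/measurable_EFinP/measurable_funTS.
  exact: continuous_measurable_fun.
have : (\int[mu]_(x in `[0%R, +oo[) ((x ^+ 2 * gaussian x)%:E + (h x)%:E) =
  \int[mu]_(x in `[0%R, +oo[) ((f x)%:E + (gaussian x)%:E))%E.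
  apply: eq_integral => x _; rewrite -!EFinD /f; congr EFin; ring.
(* The integrals of [h] and [f] both equal [expR 2], so this finite value cancels; finiteness of the
   two moments is not yet required. *)
rewrite !ge0_integralD//.
  rewrite integral_h integral_f [RHS]addeC => /(congr1 (fun z => z - (expR 2)%:E)%E).
  by rewrite !addeK.
all: try (move=> x _; rewrite lee_fin ?f_ge0 ?expR_ge0// mulr_ge0 ?sqr_ge0//;
  exact: expR_ge0).
all: apply: mc.
- exact: continuous_f.
- exact: continuous_gaussian.
- exact: continuous_sqr_gaussian.
- exact: continuous_h.
Qed.

Lemma integral_sqr_gaussian :
  (\int[mu]_x (x ^+ 2 * gaussian x)%:E = (Num.sqrt (2 * pi))%:E)%E.
Proof.
rewrite -integral_gaussian.
have E : [set x : R | 0 <= x] = `[0, +oo[%classic.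
  by apply/seteqP; split => x/=; rewrite in_itv/= andbT.
rewrite (ge0_symfun_integralT gaussian_ge0 continuous_gaussian); last first.
  by move=> x /=; rewrite gaussianN.
rewrite (ge0_symfun_integralT _ continuous_sqr_gaussian) ?E ?integral0y_sqr_gaussian//.
- by move=> x; rewrite mulr_ge0 ?sqr_ge0 ?gaussian_ge0.
- by move=> x /=; rewrite gaussianN sqrrN.
Qed.

End gaussian_moments.

(** * Affine substitution and Gaussian integrals of quadratic polynomials *)

Section gaussian_quadratic.
Context {R : realType}.
Notation mu := (@lebesgue_measure R).

Let ge0_integral_affine (G : R -> R) (m c : R) : 0 < c -> continuous G ->
  (forall x, 0 <= G x) ->
  (\int[mu]_x (G x)%:E = \int[mu]_x (c * G (m + c * x))%:E)%E.
Proof.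
move=> c0 cG G0; pose F (x : R) : R := m + c * x.
have dF (x : R) : is_derive x 1 F c.
  by apply: is_derive_eq; rewrite /GRing.scale/=; ring.
have F' : F^`()%classic = cst c.
  by apply/funext => x; rewrite derive1E; have [_ ->] := dF x.
rewrite (@increasing_ge0_integration_by_substitutionT _ F G)//.
- by apply: eq_integral => x _; rewrite F' /= mulrC.
- by move=> x y xy; rewrite ltrD2l ltr_pM2l.
- by rewrite F' => x; exact: cvg_cst.
- by rewrite F'; exact: is_cvg_cst.
- by rewrite F'; exact: is_cvg_cst.
- rewrite /F; under eq_fun do rewrite addrC mulrC.
  apply: (@cvg_comp _ _ _ (fun x => x * c) (fun x => x + m)); last exact: cvg_addrr_Ny.
  by apply/gt0_cvgMlNy => //; exact: cvg_id.
- rewrite /F; under eq_fun do rewrite addrC mulrC.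
  apply: (@cvg_comp _ _ _ (fun x => x * c) (fun x => x + m)); last exact: cvg_addrr.
  by apply/gt0_cvgMly => //; exact: cvg_id.
Qed.

(** The nonnegative case applies to the positive and negative parts separately, because a factor
    [c > 0] commutes with taking the maximum with 0. *)
Lemma integral_affine (G : R -> R) (m c : R) : 0 < c -> continuous G ->
  (\int[mu]_x (G x)%:E = \int[mu]_x (c * G (m + c * x))%:E)%E.
Proof.
move=> c0 cG; rewrite integralE [RHS]integralE; congr (_ - _)%E.
  transitivity (\int[mu]_x (Num.max (G x) 0)%:E)%E.
    by apply: eq_integral => x _; rewrite funeposE -EFin_max.
  rewrite (@ge0_integral_affine _ m c)//.
  - apply: eq_integral => x _; rewrite funeposE -EFin_max; congr EFin.
    by rewrite maxr_pMr ?mulr0// ltW.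
  - move=> x; apply: (@continuous_max _ _ G (cst 0) x); [exact: cG|exact: cst_continuous].
  - by move=> x; rewrite le_max lexx orbT.
transitivity (\int[mu]_x (Num.max (- G x) 0)%:E)%E.
  by apply: eq_integral => x _; rewrite funenegE -EFin_max.
rewrite (@ge0_integral_affine _ m c)//.
- apply: eq_integral => x _; rewrite funenegE -EFin_max; congr EFin.
  by rewrite maxr_pMr ?mulr0 ?mulrN// ltW.
- move=> x; apply: (@continuous_max _ _ (fun x => - G x) (cst 0) x); last exact: cst_continuous.
  by apply: cvgN; exact: cG.
- by move=> x; rewrite le_max lexx orbT.
Qed.

Let continuous_measurable_EFin (k : R -> R) : continuous k ->
  measurable_fun (setT : set R) (EFin \o k).
Proof.
by move=> ck; apply/measurable_EFinP; exact: continuous_measurable_fun.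
Qed.

Let ge0_integrable (k : R -> R) : continuous k -> (forall x, 0 <= k x) ->
  (\int[mu]_x (k x)%:E < +oo)%E -> mu.-integrable setT (EFin \o k).
Proof.
move=> ck k0 koo; apply/integrableP; split.
  exact: continuous_measurable_EFin.
by under eq_integral do rewrite /= ger0_norm//.
Qed.

Let integrable_gaussian : mu.-integrable setT (EFin \o gaussian).
Proof.
apply: ge0_integrable; first exact: continuous_gaussian.
  exact: gaussian_ge0.
by rewrite integral_gaussian ltry.
Qed.

Let integrable_sqr_gaussian :
  mu.-integrable setT (EFin \o (fun x : R => x ^+ 2 * gaussian x)).
Proof.
apply: ge0_integrable; first exact: continuous_sqr_gaussian.
  by move=> x; rewrite mulr_ge0 ?sqr_ge0 ?gaussian_ge0.
by rewrite integral_sqr_gaussian ltry.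
Qed.

Let continuous_id_gaussian : continuous (fun x : R => x * gaussian x).
Proof. by move=> x; apply: cvgM; [exact: cvg_id|exact: continuous_gaussian]. Qed.

Let integrable_id_gaussian :
  mu.-integrable setT (EFin \o (fun x : R => x * gaussian x)).
Proof.
(* Domination by the two even moments, from [|x| <= 1 + x ^+ 2]. *)
apply: (le_integrable _ _ _ (integrableD _ integrable_gaussian integrable_sqr_gaussian)) => //.
  by apply: continuous_measurable_EFin; exact: continuous_id_gaussian.
move=> x _; rewrite [leRHS]/= abse_EFin lee_fin.
rewrite normrM (ger0_norm (gaussian_ge0 x)).
rewrite [leRHS]ger0_norm; last first.
  by rewrite addr_ge0 ?gaussian_ge0// mulr_ge0 ?gaussian_ge0 ?sqr_ge0.
rewrite -{2}(mul1r (gaussian x)) -mulrDl ler_wpM2r ?gaussian_ge0//.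
rewrite -(real_normK (num_real x)); have := sqr_ge0 (`|x| - 1).
by have := normr_ge0 x; nra.
Qed.

Let integral_id_gaussian : (\int[mu]_x (x * gaussian x)%:E = 0)%E.
Proof.
(* The integrand is odd and Lebesgue measure is invariant under reflection; integrability makes [I]
   finite, so [I = - I] forces 0. *)
set I := (LHS); suff : I = (- I)%E.
  have : I \is a fin_num by exact: integrable_fin_num integrable_id_gaussian.
  move=> /fineK <-; rewrite -EFinN => -[] H; congr EFin.
  by move: H; lra.
rewrite {1}/I.
rewrite (eq_measure_integral (pushforward mu (-%R : _ -> measurableTypeR R))); last first.
  by move=> A mA _; exact/esym/lebesgue_measureN.
rewrite integral_pushforward//; last 2 first.
  by apply: continuous_measurable_EFin; exact: continuous_id_gaussian.
  rewrite preimage_setT.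
  apply: eq_integrable (integrableN integrable_id_gaussian) => // x _.
  by rewrite /= gaussianN mulNr.
rewrite preimage_setT /I -integralN//; last exact: integrable_add_def.
by apply: eq_integral => x _; rewrite /= gaussianN mulNr.
Qed.

Lemma integral_quad_gaussian (a b c : R) :
  (\int[mu]_x ((a + b * x + c * x ^+ 2) * gaussian x)%:E =
   ((a + c) * Num.sqrt (2 * pi))%:E)%E.
Proof.
have ig k : mu.-integrable setT (fun x => (k%:E * (gaussian x)%:E)%E).
  exact: integrableZl.
have ix k : mu.-integrable setT (fun x => (k%:E * (x * gaussian x)%:E)%E).
  exact: integrableZl.
have ixx k : mu.-integrable setT (fun x => (k%:E * (x ^+ 2 * gaussian x)%:E)%E).
  exact: integrableZl.
transitivity (\int[mu]_x (a%:E * (gaussian x)%:E + b%:E * (x * gaussian x)%:E +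
    c%:E * (x ^+ 2 * gaussian x)%:E))%E.
  by apply: eq_integral => x _; rewrite -!EFinM -!EFinD; congr EFin; ring.
rewrite (integralD measurableT (integrableD measurableT (ig a) (ix b)) (ixx c)).
rewrite (integralD measurableT (ig a) (ix b)).
rewrite (integralZl measurableT integrable_gaussian).
rewrite (integralZl measurableT integrable_id_gaussian).
rewrite (integralZl measurableT integrable_sqr_gaussian).
rewrite integral_gaussian integral_id_gaussian integral_sqr_gaussian.
by rewrite mule0 adde0 -!EFinM -EFinD -mulrDl.
Qed.

End gaussian_quadratic.

(** * Integrals of quadratic polynomials against a bivariate normal density *)

Section bivariate_normal.
Context {R : realType}.
Notation mu := (@lebesgue_measure R).

Section moments.
Variables m1 m2 s1 s2 q : R.
Hypothesis s1_gt0 : 0 < s1.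
Hypothesis s2_gt0 : 0 < s2.
Hypothesis q_gtN1 : -1 < q.
Hypothesis q_lt1 : q < 1.

Let k : R := Num.sqrt (1 - q ^+ 2).

Let q2_gt0 : 0 < 1 - q ^+ 2.
Proof. by move: q_gtN1 q_lt1; nra. Qed.

Let k_gt0 : 0 < k. Proof. by rewrite sqrtr_gt0. Qed.

Let sqr_k : k ^+ 2 = 1 - q ^+ 2. Proof. by rewrite sqr_sqrtr// ltW. Qed.

(* [u] and [w] are independent standard normal variables under the density. *)
Let u (z : R * R) : R := (z.1 - m1) / s1.
Let w (z : R * R) : R := ((z.2 - m2) / s2 - q * u z) / k.

(** Completing the square: with [v] the second standardized coordinate,
    [u ^+ 2 - 2 * q * u * v + v ^+ 2] equals [(1 - q ^+ 2) * (u ^+ 2 + w ^+ 2)]. *)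
Lemma bvn_pdf_prod (z : R * R) :
  bvn_pdf m1 m2 s1 s2 q z =
  (2 * pi * s1 * s2 * k)^-1 * (gaussian (u z) * gaussian (w z)).
Proof.
rewrite /bvn_pdf -/k; congr (_ * _); rewrite /gaussian -expRD; congr expR.
rewrite /w /u; set v := (z.2 - m2) / s2; set u' := (z.1 - m1) / s1.
rewrite [in RHS](expr_div_n (v - q * u')) sqr_k.
have := lt0r_neq0 q2_gt0 => q0.
by field.
Qed.

Let continuous_affine (a b : R) : continuous (fun x : R => a + b * x).
Proof.
by move=> x; apply: cvgD; [exact: cvg_cst|apply: cvgM; [exact: cvg_cst|exact: cvg_id]].
Qed.

(** The shape is that of the integrands to which [integral_affine] is applied below. *)
Let continuous_quad_gaussian (a b c r t : R) : continuous (fun x : R =>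
  (a + b * (r + t * x) + c * (r + t * x) ^+ 2) * gaussian (r + t * x)).
Proof.
have ca := continuous_affine r t.
move=> x; apply: cvgM; last first.
  by apply: (@continuous_comp _ _ _ (fun x => r + t * x) gaussian x (ca x)); exact: continuous_gaussian.
apply: cvgD.
  by apply: cvgD; [exact: cvg_cst|apply: cvgM; [exact: cvg_cst|exact: ca]].
apply: cvgM; first exact: cvg_cst.
by apply: (@continuous_comp _ _ _ (fun x => r + t * x) (fun y => y ^+ 2) x (ca x)); exact: exprn_continuous.
Qed.

(** The log-ratio of two bivariate normal densities takes this form in the coordinates [u] and
    [w]. *)
Definition quad (a b c d e g : R) (x y : R) : R :=
  a + b * x + c * y + d * x ^+ 2 + e * (x * y) + g * y ^+ 2.

(** For fixed [x], [w] is standard normal, so the terms odd in [w] vanish and its square contributes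
    1. The 0 in [u (x, 0)] is a placeholder, as [u] reads only the first coordinate. *)
Let integral_slice (a b c d e g : R) (x : R) :
  (\int[mu]_y (quad a b c d e g (u (x, y)) (w (x, y)) *
     bvn_pdf m1 m2 s1 s2 q (x, y))%:E =
   ((a + g + b * u (x, 0) + d * u (x, 0) ^+ 2) * gaussian (u (x, 0)) *
     (Num.sqrt (2 * pi) * s1)^-1)%:E)%E.
Proof.
have k0 := lt0r_neq0 k_gt0.
have s10 := lt0r_neq0 s1_gt0.
have s20 := lt0r_neq0 s2_gt0.
have pi0 : pi != 0 :> R by rewrite gt_eqF// pi_gt0.
set t := u (x, 0); set K := (2 * pi * s1 * s2 * k)^-1 * gaussian t.
have slice y : quad a b c d e g (u (x, y)) (w (x, y)) *
    bvn_pdf m1 m2 s1 s2 q (x, y) =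
  (K * (a + b * t + d * t ^+ 2) + K * (c + e * t) * w (x, y) +
   K * g * w (x, y) ^+ 2) * gaussian (w (x, y)).
  by rewrite bvn_pdf_prod /K /quad /t /u /=; ring.
have wE y : w (x, y) = - (m2 / s2 + q * t) / k + (s2 * k)^-1 * y.
  by rewrite /w /t /u /=; field; rewrite k0 s10 s20.
under eq_integral do rewrite slice wE.
(* These are the conditional mean and standard deviation of the second coordinate given the first;
   the substitution turns [w] into the new variable. *)
rewrite (@integral_affine _ _ (m2 + s2 * q * t) (s2 * k)) ?mulr_gt0//.
pose L := s2 * k * K.
transitivity (\int[mu]_y ((L * (a + b * t + d * t ^+ 2) + L * (c + e * t) * y +
   L * g * y ^+ 2) * gaussian y)%:E)%E.
  apply: eq_integral => y _; congr EFin.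
  have -> : - (m2 / s2 + q * t) / k + (s2 * k)^-1 *
      (m2 + s2 * q * t + s2 * k * y) = y by field; rewrite k0 s20.
  by rewrite /L; ring.
rewrite integral_quad_gaussian; congr EFin.
have sp : Num.sqrt (2 * pi : R) ^+ 2 = 2 * pi.
  by rewrite sqr_sqrtr// mulr_ge0// pi_ge0.
have sp0 : Num.sqrt (2 * pi : R) != 0.
  by rewrite gt_eqF// sqrtr_gt0 mulr_gt0// pi_gt0.
rewrite /L /K; move: sp sp0; set S := Num.sqrt _ => <- sp0.
by field; rewrite sp0 k0 s10 s20.
Qed.

Let integral_marginal (a b d : R) :
  (\int[mu]_x ((a + b * u (x, 0%R) + d * u (x, 0%R) ^+ 2) * gaussian (u (x, 0%R)) *
     (Num.sqrt (2 * pi) * s1)^-1)%:E = (a + d)%:E)%E.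
Proof.
have s10 := lt0r_neq0 s1_gt0.
have sp0 : Num.sqrt (2 * pi : R) != 0.
  by rewrite gt_eqF// sqrtr_gt0 mulr_gt0// pi_gt0.
set S := Num.sqrt _ in sp0 *.
have uE x : u (x, 0) = - (m1 / s1) + s1^-1 * x by rewrite /u /=; field.
pose L := (S * s1)^-1.
transitivity (\int[mu]_x ((L * a + L * b * (- (m1 / s1) + s1^-1 * x) +
  L * d * (- (m1 / s1) + s1^-1 * x) ^+ 2) * gaussian (- (m1 / s1) + s1^-1 * x))%:E)%E.
  by apply: eq_integral => x _; rewrite uE /L; congr EFin; ring.
rewrite (@integral_affine _ _ m1 s1)//.
transitivity (\int[mu]_x ((S^-1 * a + S^-1 * b * x + S^-1 * d * x ^+ 2) *
    gaussian x)%:E)%E.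
  apply: eq_integral => x _; congr EFin.
  have -> : - (m1 / s1) + s1^-1 * (m1 + s1 * x) = x by field.
  by rewrite /L; field; rewrite sp0 s10.
by rewrite integral_quad_gaussian -/S; congr EFin; field.
Qed.

Let integral_iterated (a b c d e g : R) :
  (\int[mu]_x \int[mu]_y (quad a b c d e g (u (x, y)) (w (x, y)) *
     bvn_pdf m1 m2 s1 s2 q (x, y))%:E = (a + d + g)%:E)%E.
Proof.
under eq_integral do rewrite integral_slice.
by rewrite integral_marginal addrAC.
Qed.

Let measurable_u : measurable_fun setT u.
Proof.
apply: measurable_funM => //; apply: measurable_funB => //.
Qed.

Let measurable_w : measurable_fun setT w.
Proof.
apply: measurable_funM => //; apply: measurable_funB => //.
  by apply: measurable_funM => //; exact: measurable_funB.
by apply: measurable_funM => //; exact: measurable_u.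
Qed.

Let measurable_integrand (a b c d e g : R) : measurable_fun setT
  (fun z => quad a b c d e g (u z) (w z) * bvn_pdf m1 m2 s1 s2 q z).
Proof.
under eq_fun do rewrite bvn_pdf_prod.
have mu_ := measurable_u; have mw := measurable_w.
apply: measurable_funM.
  rewrite /quad; do ! apply: measurable_funD => //; apply: measurable_funM => //.
  - exact: measurable_funX.
  - exact: measurable_funM.
  - exact: measurable_funX.
apply: measurable_funM => //; apply: measurable_funM.
  exact: measurableT_comp measurable_gaussian mu_.
exact: measurableT_comp measurable_gaussian mw.
Qed.

Let bvn_pdf_ge0 z : 0 <= bvn_pdf m1 m2 s1 s2 q z.
Proof.
by rewrite /bvn_pdf mulr_ge0 ?expR_ge0// invr_ge0 !mulr_ge0 ?sqrtr_ge0 ?pi_ge0// ltW.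
Qed.

(** Every monomial of degree at most two is bounded by [1 + x ^+ 2 + y ^+ 2]. *)
Let quad_bound (a b c d e g A x y : R) :
  A = `|a| + `|b| + `|c| + `|d| + `|e| + `|g| ->
  `|quad a b c d e g x y| <= quad A 0 0 A 0 A x y.
Proof.
move=> AE; have x2 := real_normK (num_real x); have y2 := real_normK (num_real y).
rewrite /quad !mul0r !addr0.
apply: (@le_trans _ _ (`|a| + `|b| * `|x| + `|c| * `|y| + `|d| * `|x| ^+ 2 +
   `|e| * (`|x| * `|y|) + `|g| * `|y| ^+ 2)).
  by rewrite -!normrX -!normrM; do 5 (apply: (le_trans (ler_normD _ _)); rewrite lerD//).
rewrite -x2 -y2.
have lin (t : R) : t <= 1 + t ^+ 2 by have := sqr_ge0 (t - 1); nra.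
have xy : `|x| * `|y| <= `|x| ^+ 2 + `|y| ^+ 2.
  by have := sqr_ge0 (`|x| - `|y|); have := sqr_ge0 (`|x| + `|y|); nra.
pose B := 1 + `|x| ^+ 2 + `|y| ^+ 2.
have -> : A + A * `|x| ^+ 2 + A * `|y| ^+ 2 = `|a| * B + `|b| * B + `|c| * B +
  `|d| * B + `|e| * B + `|g| * B by rewrite AE /B; ring.
have X := sqr_ge0 `|x|; have Y := sqr_ge0 `|y|.
have lx := lin `|x|; have ly := lin `|y|.
rewrite -{1}(mulr1 `|a|).
by do 5 (apply: lerD; last (apply: ler_wpM2l => //; rewrite /B; lra));
  apply: ler_wpM2l => //; rewrite /B; lra.
Qed.

Lemma integral_quad_bvn (a b c d e g : R) :
  (\int[mu \x mu]_z (quad a b c d e g (u z) (w z) *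
     bvn_pdf m1 m2 s1 s2 q z)%:E = (a + d + g)%:E)%E.
Proof.
rewrite -integral12_prod_meas1; first exact: integral_iterated.
pose f a b c d e g z := quad a b c d e g (u z) (w z) * bvn_pdf m1 m2 s1 s2 q z.
have mf a' b' c' d' e' g' : measurable_fun setT (EFin \o f a' b' c' d' e' g').
  by apply/measurable_EFinP; exact: measurable_integrand.
apply/integrableP; split; first exact: (mf a b c d e g).
pose A := `|a| + `|b| + `|c| + `|d| + `|e| + `|g|.
have fA z : `|f a b c d e g z| <= f A 0 0 A 0 A z.
  by rewrite /f normrM (ger0_norm (bvn_pdf_ge0 z)) ler_wpM2r// quad_bound.
(* Fubini needs integrability. The dominating function is nonnegative and again of the form [quad],
   so Tonelli and the iterated integral show that its integral is finite. *)
apply: (@le_lt_trans _ _ (\int[mu \x mu]_z (f A 0 0 A 0 A z)%:E)%E).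
  apply: ge0_le_integral => //.
  - exact: measurableT_comp (mf a b c d e g).
  - exact: mf.
  - by move=> z _; rewrite lee_fin; exact: fA.
rewrite fubini_tonelli1; first by rewrite integral_iterated ltry.
  exact: mf.
by move=> z; rewrite lee_fin (le_trans _ (fA z)).
Qed.

End moments.
End bivariate_normal.

(** * Closed form of the relative entropy *)

Section entropy.
Context {R : realType}.
Implicit Types mx my sx sy r q : R.

(* The least relative entropy from the prior with correlation [r] among the
   bivariate normal distributions of correlation [q]. *)
Definition corr_cost r q : R :=
  ln ((1 - r * q) / (Num.sqrt (1 - q ^+ 2) * Num.sqrt (1 - r ^+ 2))).

Lemma subr_sqr_gt0 r : -1 < r -> r < 1 -> 0 < 1 - r ^+ 2.
Proof. by nra. Qed.

Lemma subr_mul_gt0 r q : -1 < r -> r < 1 -> -1 < q -> q < 1 -> 0 < 1 - r * q.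
Proof. by nra. Qed.

Lemma ln_bvn_pdf m1 m2 s1 s2 q (z : R * R) :
  0 < s1 -> 0 < s2 -> -1 < q -> q < 1 ->
  ln (bvn_pdf m1 m2 s1 s2 q z) =
  - ln (2 * pi * s1 * s2 * Num.sqrt (1 - q ^+ 2)) -
  (((z.1 - m1) / s1) ^+ 2 - 2 * q * ((z.1 - m1) / s1) * ((z.2 - m2) / s2) +
   ((z.2 - m2) / s2) ^+ 2) / (2 * (1 - q ^+ 2)).
Proof.
move=> s10 s20 qN1 q1.
have C0 : 0 < 2 * pi * s1 * s2 * Num.sqrt (1 - q ^+ 2).
  by rewrite !mulr_gt0 ?pi_gt0// sqrtr_gt0 subr_sqr_gt0.
by rewrite /bvn_pdf /= [LHS]lnM ?posrE ?invr_gt0 ?expR_gt0// lnV ?posrE// expRK mulNr.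
Qed.

(* Completing the square in [a ^+ 2 - 2 * r * q * a * b + b ^+ 2] displays the
   excess over [corr_cost r q] as a sum of nonnegative terms. *)
Lemma rel_entropy_bvn mx my sx sy r m1 m2 s1 s2 q :
  0 < sx -> 0 < sy -> -1 < r -> r < 1 ->
  0 < s1 -> 0 < s2 -> -1 < q -> q < 1 ->
  let a := s1 / sx in let b := s2 / sy in
  let d1 := (m1 - mx) / sx in let d2 := (m2 - my) / sy in
  let t := a * b * (1 - r * q) / (1 - r ^+ 2) in
  rel_entropy (bvn_pdf m1 m2 s1 s2 q) (bvn_pdf mx my sx sy r) =
  (corr_cost r q +
   ((a - b) ^+ 2 + (d1 ^+ 2 - 2 * r * d1 * d2 + d2 ^+ 2)) / (2 * (1 - r ^+ 2)) +
   (t - 1 - ln t))%:E.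
Proof.
move=> sx0 sy0 rN1 r1 s10 s20 qN1 q1 a b d1 d2 t.
have r20 := subr_sqr_gt0 r rN1 r1; have q20 := subr_sqr_gt0 q qN1 q1.
have rq0 := subr_mul_gt0 r q rN1 r1 qN1 q1.
pose k := Num.sqrt (1 - q ^+ 2); pose l := Num.sqrt (1 - r ^+ 2).
have k0 : 0 < k by rewrite sqrtr_gt0.
have l0 : 0 < l by rewrite sqrtr_gt0.
have k2 : k ^+ 2 = 1 - q ^+ 2 by rewrite sqr_sqrtr// ltW.
have l2 : l ^+ 2 = 1 - r ^+ 2 by rewrite sqr_sqrtr// ltW.
have [kn lneq0 sxn syn] : [/\ k != 0, l != 0, sx != 0 & sy != 0].
  by split; exact: lt0r_neq0.
have [s1n s2n r2n q2n] :
    [/\ s1 != 0, s2 != 0, 1 - r ^+ 2 != 0 & 1 - q ^+ 2 != 0].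
  by split; exact: lt0r_neq0.
have t0 : 0 < t by rewrite /t /a /b !mulr_gt0 ?invr_gt0.
pose C := 2 * pi * sx * sy * l; pose C' := 2 * pi * s1 * s2 * k.
have C0 : 0 < C by rewrite !mulr_gt0 ?pi_gt0.
have C'0 : 0 < C' by rewrite !mulr_gt0 ?pi_gt0.
have lnC : ln C - ln C' = corr_cost r q - ln t.
  have X0 : 0 < (1 - r * q) / (k * l) by rewrite divr_gt0// mulr_gt0.
  apply/eqP; rewrite subr_eq addrAC eq_sym subr_eq -!lnM ?posrE//.
  apply/eqP; congr ln.
  by rewrite /C /C' /t /a /b -/k -/l -l2; field; rewrite lneq0 kn sxn syn.
pose D := 2 * (1 - r ^+ 2).
(* With [v = q * u + k * w], the scaled coordinate [b * v] becomes [be * u + ga * w]; the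
   coefficients of [quad] below come from expanding the log-ratio in [u] and [w]. *)
pose be := b * q; pose ga := b * k.
transitivity (\int[@lebesgue_measure R \x @lebesgue_measure R]_z
  (quad (ln C - ln C' + (d1 ^+ 2 - 2 * r * d1 * d2 + d2 ^+ 2) / D)
    ((2 * a * d1 - 2 * r * (a * d2 + be * d1) + 2 * be * d2) / D)
    ((2 * ga * d2 - 2 * r * ga * d1) / D)
    ((a ^+ 2 - 2 * r * a * be + be ^+ 2) / D - 1 / 2)
    ((2 * be * ga - 2 * r * a * ga) / D)
    (ga ^+ 2 / D - 1 / 2)
    ((z.1 - m1) / s1) (((z.2 - m2) / s2 - q * ((z.1 - m1) / s1)) / k) *
    bvn_pdf m1 m2 s1 s2 q z)%:E)%E.
  apply: eq_integral => z _; congr EFin; rewrite mulrC; congr (_ * _).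
  rewrite !ln_bvn_pdf// -/k -/l -/C -/C'.
  set u := (z.1 - m1) / s1; set v := (z.2 - m2) / s2.
  have -> : (z.1 - mx) / sx = a * u + d1 by rewrite /a /u /d1; field; rewrite sxn s1n.
  have -> : (z.2 - my) / sy = b * v + d2 by rewrite /b /v /d2; field; rewrite syn s2n.
  pose w := (v - q * u) / k.
  have -> : v = q * u + k * w by rewrite /w; field.
  have -> : (q * u + k * w - q * u) / k = w by field.
  have -> : (u ^+ 2 - 2 * q * u * (q * u + k * w) + (q * u + k * w) ^+ 2) /
      (2 * (1 - q ^+ 2)) = (u ^+ 2 + w ^+ 2) / 2.
    have -> : u ^+ 2 - 2 * q * u * (q * u + k * w) + (q * u + k * w) ^+ 2 =
        u ^+ 2 * (1 - q ^+ 2) + k ^+ 2 * w ^+ 2 by ring.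
    by rewrite k2; field.
  by rewrite /quad /D /be /ga; field; rewrite r2n.
(* Only the constant and the two square coefficients survive. Since [be ^+ 2 + ga ^+ 2 = b ^+ 2],
   the squares give [(a - b) ^+ 2 / D + t - 1]. *)
rewrite integral_quad_bvn//; congr EFin; rewrite lnC.
have -> : (t : R) = 2 * a * b * (1 - r * q) / D by rewrite /t /D; field.
have -> : ga ^+ 2 = b ^+ 2 * (1 - q ^+ 2) by rewrite /ga exprMn k2.
by rewrite /D /be; field; rewrite r2n.
Qed.

End entropy.

(** * Minimizers under a view on the correlation *)

Section posterior.
Context {R : realType}.
Implicit Types mx my sx sy r q t : R.

Let ln_lt_subr1 t : 0 < t -> t != 1 -> ln t < t - 1.
Proof.
move=> t0 t1; rewrite ltrBrDl -{2}(lnK (t0 : t \is Num.pos)).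
by apply: expR_gt1Dx; rewrite ln_eq0.
Qed.

(** Removing logarithms and squaring leaves a polynomial inequality whose difference of sides
    factors as the last hypothesis. That product is positive when [q0] lies between [r] and [q] and
    differs from [q]. *)
Lemma corr_cost_lt r q0 q :
  -1 < r -> r < 1 -> -1 < q0 -> q0 < 1 -> -1 < q -> q < 1 ->
  0 < (q - q0) * ((q - r) * (1 - r * q0) + (q0 - r) * (1 - r * q)) ->
  corr_cost r q0 < corr_cost r q.
Proof.
move=> rN1 r1 q0N1 q01 qN1 q1 H.
have r2 := subr_sqr_gt0 r rN1 r1.
have q02 := subr_sqr_gt0 q0 q0N1 q01; have q2 := subr_sqr_gt0 q qN1 q1.
have A0 := subr_mul_gt0 r q0 rN1 r1 q0N1 q01.
have A := subr_mul_gt0 r q rN1 r1 qN1 q1.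
rewrite /corr_cost ltr_ln ?posrE ?divr_gt0 ?mulr_gt0 ?sqrtr_gt0//.
rewrite !invfM !mulrA ltr_pM2r ?invr_gt0 ?sqrtr_gt0//.
rewrite ltr_pdivrMr ?sqrtr_gt0// mulrAC ltr_pdivlMr ?sqrtr_gt0//.
rewrite -ltr_sqr ?nnegrE ?mulr_ge0 ?sqrtr_ge0 ?(ltW A) ?(ltW A0)//.
rewrite !exprMn !sqr_sqrtr ?ltW// -subr_gt0.
suff <- : (q - q0) * ((q - r) * (1 - r * q0) + (q0 - r) * (1 - r * q)) =
  (1 - r * q) ^+ 2 * (1 - q0 ^+ 2) - (1 - r * q0) ^+ 2 * (1 - q ^+ 2) by [].
by ring.
Qed.

(** Every excess term over [corr_cost r q0] is nonnegative, and all vanish at the prior means with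
    both deviations scaled by [la]. A posterior therefore makes each of them vanish, which fixes its
    second mean and deviation. *)
Lemma CoVaR_view_minimizer (V : R -> Prop) alpha mx my sx sy r q0 :
  0 < sx -> 0 < sy -> -1 < r -> r < 1 -> -1 < q0 -> q0 < 1 -> V q0 ->
  (forall q, -1 < q -> q < 1 -> V q -> q != q0 -> corr_cost r q0 < corr_cost r q) ->
  CoVaR_view_is V alpha mx my sx sy r
    (my + sy * Num.sqrt ((1 - r ^+ 2) / (1 - r * q0)) * Phi_inv alpha).
Proof.
move=> sx0 sy0 rN1 r1 q0N1 q01 Vq0 min_q0.
have r2 := subr_sqr_gt0 r rN1 r1.
have A0 := subr_mul_gt0 r q0 rN1 r1 q0N1 q01.
(* The common scale [a = b = la] for which [t = 1] at correlation [q0]. *)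
set la := Num.sqrt _.
have la2 : la ^+ 2 = (1 - r ^+ 2) / (1 - r * q0).
  by rewrite sqr_sqrtr// divr_ge0 ?ltW.
have la0 : 0 < la by rewrite sqrtr_gt0 divr_gt0.
have cost0 : rel_entropy (bvn_pdf mx my (sx * la) (sy * la) q0)
    (bvn_pdf mx my sx sy r) = (corr_cost r q0)%:E.
  rewrite rel_entropy_bvn ?mulr_gt0//; congr EFin.
  rewrite !subrr !mul0r.
  have -> : sx * la / sx = la by field; exact: lt0r_neq0.
  have -> : sy * la / sy = la by field; exact: lt0r_neq0.
  have -> : la * la * (1 - r * q0) / (1 - r ^+ 2) = 1.
    rewrite -expr2 la2; field; rewrite !lt0r_neq0//.
  by rewrite ln1; ring.
pose gap (a b d1 d2 : R) :=
  ((a - b) ^+ 2 + (d1 ^+ 2 - 2 * r * d1 * d2 + d2 ^+ 2)) / (2 * (1 - r ^+ 2)).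
have quad_ge0 (d1 d2 : R) : (1 - r ^+ 2) * d2 ^+ 2 <= d1 ^+ 2 - 2 * r * d1 * d2 + d2 ^+ 2.
  by rewrite -subr_ge0 (_ : _ - _ = (d1 - r * d2) ^+ 2) ?sqr_ge0//; ring.
have gap_ge0 a b d1 d2 : 0 <= gap a b d1 d2.
  apply: divr_ge0; last by rewrite mulr_ge0// ltW.
  apply: addr_ge0; first exact: sqr_ge0.
  by apply: le_trans (quad_ge0 d1 d2); rewrite mulr_ge0 ?sqr_ge0// ltW.
(* Only [d2] is extracted, since CoVaR involves the mean of the second coordinate alone. *)
have gap_le0 a b d1 d2 : gap a b d1 d2 <= 0 -> a = b /\ d2 = 0.
  rewrite ler_pdivrMr ?mul0r ?mulr_gt0// => gap0.
  have := quad_ge0 d1 d2; have sab := sqr_ge0 (a - b); have sd := sqr_ge0 d2.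
  have pd := mulr_ge0 (ltW r2) sd => qd; split.
    apply/eqP; rewrite -subr_eq0 -sqrf_eq0 eq_le sab andbT; lra.
  have : (1 - r ^+ 2) * d2 ^+ 2 == 0 by rewrite eq_le pd andbT; lra.
  by rewrite mulf_eq0 gt_eqF//= sqrf_eq0 => /eqP.
have log_gap t : 0 < t -> 0 <= t - 1 - ln t.
  move=> t0; have [->|t1] := eqVneq t 1; first by rewrite ln1; lra.
  by have := ln_lt_subr1 t t0 t1; lra.
split.
  exists mx, my, (sx * la), (sy * la), q0; split; first by rewrite /bvn_params !mulr_gt0.
  split; first exact: Vq0.
  move=> m1 m2 s1 s2 q [s10 [s20 [qN1 q1]]] Vq.
  rewrite cost0 rel_entropy_bvn// lee_fin.
  have A := subr_mul_gt0 r q rN1 r1 qN1 q1.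
  set t := _ * _ / _; have t0 : 0 < t by rewrite /t !mulr_gt0 ?invr_gt0.
  have := log_gap t t0.
  have := gap_ge0 (s1 / sx) (s2 / sy) ((m1 - mx) / sx) ((m2 - my) / sy).
  rewrite /gap.
  have [->|/(min_q0 q qN1 q1 Vq)] := eqVneq q q0; lra.
move=> m1 m2 s1 s2 q [[s10 [s20 [qN1 q1]]] [Vq minq]].
have A := subr_mul_gt0 r q rN1 r1 qN1 q1.
(* Comparing an arbitrary posterior with the explicit candidate bounds its total cost by
   [corr_cost r q0]. *)
have := minq mx my (sx * la) (sy * la) q0; rewrite cost0 rel_entropy_bvn// lee_fin.
have params0 : bvn_params mx my (sx * la) (sy * la) q0 by rewrite /bvn_params !mulr_gt0.
set t := _ * _ / _; have t0 : 0 < t by rewrite /t !mulr_gt0 ?invr_gt0.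
move=> /(_ params0 Vq0).
have lt := log_gap t t0.
have := gap_ge0 (s1 / sx) (s2 / sy) ((m1 - mx) / sx) ((m2 - my) / sy).
have := gap_le0 (s1 / sx) (s2 / sy) ((m1 - mx) / sx) ((m2 - my) / sy).
rewrite -/(gap _ _ _ _); set g := gap _ _ _ _ => g0 g_ge0 le.
have [qE|/(min_q0 q qN1 q1 Vq)] := eqVneq q q0; last by lra.
rewrite qE in le *.
have [ab d20] : s1 / sx = s2 / sy /\ (m2 - my) / sy = 0 by apply: g0; lra.
have t1 : t = 1.
  by apply/eqP/negPn/negP => t1; have := ln_lt_subr1 t t0 t1; lra.
have m2E : m2 = my.
  by apply/eqP; rewrite -subr_eq0; move/eqP: d20; rewrite mulf_eq0 invr_eq0 (gt_eqF sy0) orbF.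
have s2E : s2 = sy * la.
  (* With [a = b], the equation [t = 1] reads [b ^+ 2 = la ^+ 2], and both sides are squares of
     positive numbers. *)
  have b0 : 0 < s2 / sy by rewrite divr_gt0.
  suff <- : s2 / sy = la by field; exact: lt0r_neq0.
  apply/eqP; rewrite -(eqrXn2 (n := 2)) ?ltW// la2.
  move: t1; rewrite /t ab qE -expr2 => /(congr1 (fun z => z * ((1 - r ^+ 2) / (1 - r * q0)))).
  rewrite mul1r => <-; apply/eqP; field; rewrite !lt0r_neq0//.
by rewrite /CoVaR_post m2E s2E.
Qed.

End posterior.

(** * The equality view and the two inequality views *)

Theorem theorem3p4 (R : realType) (mux muy sx sy rho alpha rho1 : R) :
  0 < sx -> 0 < sy -> -1 < rho -> rho < 1 -> 0 < alpha -> alpha < 1 ->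
  -1 < rho1 -> rho1 < 1 ->
  let covar_eq :=
    muy + sy * Num.sqrt ((1 - rho ^+ 2) / (1 - rho * rho1)) * Phi_inv alpha in
  (* (i) equality view *)
  CoVaR_view_is (fun r => r = rho1) alpha mux muy sx sy rho covar_eq /\
  (* (ii) view  rho~ <= rho1 *)
  (rho <= rho1 ->
     CoVaR_view_is (fun r => r <= rho1) alpha mux muy sx sy rho (VaR alpha muy sy)) /\
  (rho1 < rho ->
     CoVaR_view_is (fun r => r <= rho1) alpha mux muy sx sy rho covar_eq) /\
  (* (iii) view  rho~ >= rho1 *)
  (rho1 <= rho ->
     CoVaR_view_is (fun r => rho1 <= r) alpha mux muy sx sy rho (VaR alpha muy sy)) /\
  (rho < rho1 ->
     CoVaR_view_is (fun r => rho1 <= r) alpha mux muy sx sy rho covar_eq).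
Proof.
move=> sx0 sy0 rN1 r1 _ _ r1N1 r11 covar_eq.
(* VaR is the CoVaR formula at correlation [rho], where the scale factor is 1. *)
have VaRE : VaR alpha muy sy =
    muy + sy * Num.sqrt ((1 - rho ^+ 2) / (1 - rho * rho)) * Phi_inv alpha.
  rewrite -expr2 divff ?sqrtr1 ?mulr1//.
  by apply: lt0r_neq0; exact: subr_sqr_gt0.
have prior_min q : -1 < q -> q < 1 -> q != rho -> corr_cost rho rho < corr_cost rho q.
  move=> qN1 q1 qr; apply: corr_cost_lt => //.
  rewrite subrr mul0r addr0 mulrA -expr2 mulr_gt0//.
    by rewrite exprn_even_gt0//= subr_eq0.
  by rewrite -expr2 subr_sqr_gt0.
split; last split; last split; last split.
- by apply: CoVaR_view_minimizer => // q _ _ ->; rewrite eqxx.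
- move=> rr1; rewrite VaRE; apply: CoVaR_view_minimizer => // q qN1 q1 _.
  exact: prior_min.
(* The view binds: for [q < rho1 < rho] both factors in [corr_cost_lt] are negative. *)
- move=> r1r; apply: CoVaR_view_minimizer => // q qN1 q1 qr1 qn.
  have {qr1 qn}qr1 : q < rho1 by rewrite lt_neqAle qn.
  apply: corr_cost_lt => //.
  have A := subr_mul_gt0 rho q rN1 r1 qN1 q1.
  have A1 := subr_mul_gt0 rho rho1 rN1 r1 r1N1 r11.
  have q0 : q - rho < 0 by rewrite subr_lt0 (lt_trans qr1).
  rewrite -subr_lt0 in qr1; rewrite -subr_lt0 in r1r.
  by rewrite nmulr_rgt0// -oppr_gt0 opprD addr_gt0// oppr_gt0 pmulr_llt0.
- move=> rr1; rewrite VaRE; apply: CoVaR_view_minimizer => // q qN1 q1 _.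
  exact: prior_min.
(* Mirror case: for [rho < rho1 < q] both factors are positive. *)
- move=> rr1; apply: CoVaR_view_minimizer => // q qN1 q1 qr1 qn.
  have {qr1 qn}qr1 : rho1 < q by rewrite lt_neqAle eq_sym qn.
  apply: corr_cost_lt => //.
  have A := subr_mul_gt0 rho q rN1 r1 qN1 q1.
  have A1 := subr_mul_gt0 rho rho1 rN1 r1 r1N1 r11.
  have q0 : 0 < q - rho by rewrite subr_gt0 (lt_trans rr1).
  rewrite -subr_gt0 in qr1; rewrite -subr_gt0 in rr1.
  by rewrite mulr_gt0// addr_gt0// mulr_gt0.
Qed.
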